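(* For every integer $t>0$, $$D^*(t,1)\ \ge\ \frac{3t-2}{2}.$$ Moreover, for every positive integer $z\ge 2$ and $t=5\cdot 2^{z-2}-1$, $$D^*(t,1)\ \le\ 2^{z+1}-2,$$ which implies $D^*(t,1)\le \frac{8t-2}{5}$. Consequently, the upper and lower bound only differ by a constant factor $1.07$.
   Context: For a positive integer $n$ let $[n]=\{1,\dots,n\}$, and for a finite set $S$ of integers let $\Sigma(S)=\sum_{x\in S}x$. Balanced defining sets: for a positive integer $t$, $\mathcal S_t$ is the set of all ordered tuples $(S_1,\dots,S_{2t})$ of pairwise disjoint 2-element sets with $\bigcup_i S_i=[4t]$ such that $\Sigma(S_{2i-1})=\Sigma(S_{2i})$ for all $i\in[t]$. The sets $S_{2i-1},S_{2i}$ are called companion sets. Swaps: for a positive integer $p$, $\mathcal I_{t,p}$ is the family of all (possibly empty) finite sets of swaps $I=\{(i_1,j_1),\dots,(i_m,j_m)\}$, where $i_1,\dots,i_m,j_1,\dots,j_m\in[4t]$ are all distinct and $|i_\ell-j_\ell|\le p$ for all $\ell$ (a swap $(i,j)$ is regarded as unordered). Applying $I$ to $(S_1,\dots,S_{2t})$ means exchanging the labels $i_\ell$ and $j_\ell$ for every $\ell$; the resulting sets are denoted $S'_1,\dots,S'_{2t}$. Discrepancy: $D(S_1,\dots,S_{2t};I;t)=\sum_{i=1}^t|\Sigma(S'_{2i-1})-\Sigma(S'_{2i})|$, and $$D^*(t,p)=\min_{(S_1,\dots,S_{2t})\in\mathcal S_t}\ \max_{I\in\mathcal I_{t,p}} 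D(S_1,\dots,S_{2t};I;t).$$
   Formalization: The final claim that the bounds differ by a factor 1.07 fails for small z (at z = 2, t = 4 the bounds are 6 and 5, ratio 1.2); it is stated for all sufficiently large z, where (8t-2)/5 is at most 1.07 times (3t-2)/2. *)

(* Defs.v *)
From mathcomp Require Import all_boot all_order all_algebra.
From mathcomp Require Import zify.
Set Implicit Arguments. Unset Strict Implicit. Unset Printing Implicit Defensive.

(* The ordinal x : 'I_n stands for the integer x.+1 of [n] = {1, ..., n}. *)
Definition Sigma n (A : {set 'I_n}) : nat := \sum_(x in A) x.+1.

(* Tuples are indexed from 0: the companions S_{2i-1}, S_{2i}, 1 <= i <= t, sit
   at positions 2 * i and (2 * i).+1 for i < t. *)
Definition balanced t : {set (2 * t).-tuple {set 'I_(4 * t)}} :=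
  [set S : (2 * t).-tuple {set 'I_(4 * t)} |
    [&& [forall i, #|tnth S i| == 2],
        [forall i, forall j, (i != j) ==> [disjoint tnth S i & tnth S j]],
        \bigcup_i tnth S i == [set: 'I_(4 * t)]
      & [forall i : 'I_t,
          Sigma (nth set0 S (2 * i)) == Sigma (nth set0 S (2 * i).+1)]]].

(* An unordered swap (i, j) is the two-element set of its endpoints; as each
   member has two elements, trivIset says that all endpoints are distinct. *)
Definition swap_sets t p : {set {set {set 'I_(4 * t)}}} :=
  [set I : {set {set 'I_(4 * t)}} | trivIset I &&
     [forall A in I, (#|A| == 2) && [forall x in A, forall y in A, x <= y + p]]].

Definition swap_label n (I : {set {set 'I_n}}) (x : 'I_n) : 'I_n :=
  if [pick y | (y != x) && ([set x; y] \in I)] is Some y then y else x.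

Definition apply_swaps n (I : {set {set 'I_n}}) (A : {set 'I_n}) : {set 'I_n} :=
  [set swap_label I x | x in A].

Definition discrepancy t (S : (2 * t).-tuple {set 'I_(4 * t)})
    (I : {set {set 'I_(4 * t)}}) : nat :=
  \sum_(i < t) absz (Posz (Sigma (apply_swaps I (nth set0 S (2 * i))))
                     - Posz (Sigma (apply_swaps I (nth set0 S (2 * i).+1))))%R.

(* swap_sets t p contains set0, so this maximum is over a nonempty set. *)
Definition max_discrepancy t p (S : (2 * t).-tuple {set 'I_(4 * t)}) : nat :=
  \max_(I in swap_sets t p) discrepancy S I.

Lemma balanced_neq0 t : exists S, S \in balanced t.
Proof.
have le24 : 2 * t <= 4 * t by rewrite leq_mul2r orbT.
pose f (i : 'I_(2 * t)) : 'I_(4 * t) := widen_ord le24 i.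
pose g (i : 'I_(2 * t)) : {set 'I_(4 * t)} := [set f i; rev_ord (f i)].
have sumg i : Sigma (g i) = (4 * t).+1.
  rewrite /Sigma big_setU1 ?big_set1 /=; last first.
    by rewrite inE -val_eqE /=; case: i => i /=; lia.
  by case: i => i /=; lia.
exists [tuple g i | i < 2 * t]; rewrite inE; apply/and4P; split.
- apply/forallP=> i; rewrite tnth_mktuple cards2 -val_eqE /=.
  by case: i => i /= lti; rewrite (_ : i != _ = true) //; lia.
- apply/forallP=> i; apply/forallP=> j; apply/implyP; rewrite !tnth_mktuple.
  move=> neij; apply/pred0P=> x /=; rewrite !inE -!val_eqE /=.
  by move: neij; rewrite -val_eqE /=; case: i j => i ? [j ?] /=; lia.
- apply/eqP/setP=> x; rewrite inE; apply/bigcupP.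
  case: (ltnP x (2 * t)) => [ltx | lex].
    exists (Ordinal ltx) => //; rewrite tnth_mktuple !inE -!val_eqE /=.
    by rewrite eqxx.
  have ltx : 4 * t - x.+1 < 2 * t by case: x lex => x /=; lia.
  exists (Ordinal ltx) => //; rewrite tnth_mktuple !inE -!val_eqE /=.
  by case: x lex ltx => x /=; lia.
- apply/forallP=> i.
  have lt1 : 2 * i < 2 * t by case: i => i /=; lia.
  have lt2 : (2 * i).+1 < 2 * t by case: i {lt1} => i /=; lia.
  rewrite -[2 * i]/(val (Ordinal lt1)) -(tnth_nth _ _ (Ordinal lt1)).
  rewrite -[(2 * i).+1]/(val (Ordinal lt2)) -(tnth_nth _ _ (Ordinal lt2)).
  by rewrite !tnth_mktuple !sumg.
Qed.

Lemma attained_max_discrepancy t p :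
  exists d, [exists S in balanced t, max_discrepancy p S == d].
Proof.
have [S balS] := balanced_neq0 t.
by exists (max_discrepancy p S); apply/existsP; exists S; rewrite balS eqxx.
Qed.

Definition Dstar t p : nat := ex_minn (attained_max_discrepancy t p).

(* Main.v *)
(** Give every quadruple of companions an orientation [sigma i] and colour each label
    by the orientation of its quadruple, reversed on the second companion. For a
    fixed orientation the signed sum of the differences of the swapped companion
    sums is a sum, over the swapped pairs [x], [x + 1], of the drop in colour from [x]
    to [x + 1]. Descents (true followed by false) never overlap, so the maximal
    discrepancy is twice the maximal number of descents over all orientations.

    Lower bound: reversing all orientations exchanges ascents and descents, so twice
    the maximal number of descents is at least the number of colour changes. A random
    orientation separates adjacent labels with probability at least 1/2 unless they
    form one of the sets; companions have the same sum and so cannot both be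
    of the form [{x, x + 1}], hence there are at most [t] exceptions and on
    average at least [(4 t - 1 - t) / 2] changes.

    Upper bound: a computer search finds an arrangement with [t = 4] and at most 3
    descents, and an arrangement for [t] with at most [M] descents yields one for
    [2 t + 1] with at most [2 M + 1]. *)

Require Import Defs.
From mathcomp Require Import all_boot all_order all_algebra.
From mathcomp Require Import zify lra.
Set Implicit Arguments. Unset Strict Implicit. Unset Printing Implicit Defensive.
Import Order.TTheory GRing.Theory Num.Theory.
Local Open Scope ring_scope.

(** * Descents of boolean words *)

Fixpoint descents (x : bool) (s : seq bool) : nat :=
  if s is y :: s' then ((x && ~~ y) + descents y s')%N else 0%N.

Lemma descents_cat x u v :
  descents x (u ++ v) = (descents x u + descents (last x u) v)%N.
Proof. by elim: u x => //= y u IHu x; rewrite IHu addnA. Qed.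

Lemma descents_rcons_true x s : descents x (rcons s true) = descents x s.
Proof. by rewrite -cats1 descents_cat /= andbF !addn0. Qed.

(** Ascents and descents alternate, so descents minus ascents is the first letter minus the last;
    ascents are the descents of the complement. *)
Lemma descents_rcons_false x s :
  descents x (rcons s false) = (x + descents (~~ x) (map negb s))%N.
Proof.
elim: s x => [|y s IHs] x /=; first by rewrite andbT.
by rewrite IHs; case: x; case: y => /=; lia.
Qed.

(** The initial [false] starts no descent; the guard [k.+1 < size s] excludes the last position,
    where the default [false] would pass for one. *)
Lemma descents_nth s :
  descents false s =
  (\sum_(k < size s) [&& k.+1 < size s, nth false s k & ~~ nth false s k.+1])%N.
Proof.
have E x u : descents x u =
    (\sum_(k < size u) (nth false (x :: u) k && ~~ nth false u k))%N.
  elim: u x => [|y u IHu] x; first by rewrite big_ord0.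
  by rewrite big_ord_recl /= IHu.
case: s => [|y s]; first by rewrite big_ord0.
rewrite /= E big_ord_recr /= ltnn addn0; apply: eq_bigr => k _ /=.
by rewrite ltnS ltn_ord.
Qed.

(* A block [p] is a position of the tuple: quadruple [p./2], companion [odd p]. *)
Definition colour (sigma : nat -> bool) (p : nat) : bool := sigma p./2 (+) odd p.

(** * Swaps as involutions moving labels by at most one *)

Section Swaps.
Variables (n : nat) (I : {set {set 'I_n}}).
Hypothesis trivI : trivIset I.

(** Distinct members of [I] are disjoint, so [x] has only one partner for [pick] to find. *)
Lemma swap_labelE x y : y != x -> [set x; y] \in I -> swap_label I x = y.
Proof.
move=> neyx xyI; rewrite /swap_label; case: pickP => [z /andP[nezx xzI] | /(_ y)].
  apply/eqP; apply: contraTT isT => nezy.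
  have /(trivIsetP trivI _ _ xyI xzI) : [set x; y] != [set x; z].
    apply: contraNneq nezy => E.
    have : z \in [set x; y] by rewrite E !inE eqxx orbT.
    by rewrite !inE (negPf nezx).
  by rewrite disjoint_subset => /subsetP/(_ x); rewrite !inE eqxx => /(_ isT).
by rewrite neyx xyI.
Qed.

Lemma swap_labelP x :
  swap_label I x = x \/
  swap_label I x != x /\ [set x; swap_label I x] \in I.
Proof.
have E := erefl (swap_label I x); move: E; rewrite {1}/swap_label.
case: pickP => [z /andP[nezx xzI] <- | _ E]; first by right.
by left; rewrite -E.
Qed.

Lemma swap_labelK : involutive (swap_label I).
Proof.
move=> x; case: (swap_labelP x) => [E | []]; first by rewrite !E.
by move=> ne xI; apply: swap_labelE; rewrite 1?eq_sym // setUC.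
Qed.

Lemma Sigma_apply_swaps A :
  Sigma (apply_swaps I A) = (\sum_(x in A) (swap_label I x).+1)%N.
Proof. by rewrite /Sigma big_imset //= => x y _ _; apply: (inv_inj swap_labelK). Qed.

End Swaps.

Lemma swap_near t I (x : 'I_(4 * t)) :
  I \in swap_sets t 1 -> (swap_label I x <= x.+1)%N && (x <= (swap_label I x).+1)%N.
Proof.
rewrite inE => /andP[trivI /forall_inP adjI].
case: (swap_labelP I x) => [-> | [_ /adjI/andP[_ /forall_inP near]]].
  by rewrite leqnSn.
have /forall_inP/(_ _ (set22 _ _)) := near _ (set21 _ _).
have /forall_inP/(_ _ (set21 _ _)) := near _ (set22 _ _).
by rewrite !addn1 => -> ->.
Qed.

Definition sg (b : bool) : int := if b then 1 else - 1.

(** A move up counts [sg (y x)], a move down its negative; reindexing along [f] joins each move down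
    to the move up of its partner. *)
Lemma sum_displacement n (f : 'I_n -> 'I_n) (y : nat -> bool) :
  involutive f -> (forall x, (f x <= x.+1)%N && (x <= (f x).+1)%N) ->
  \sum_(x < n) sg (y x) * ((f x)%:Z - x%:Z) =
  \sum_(x < n | f x == x.+1 :> nat) (sg (y x) - sg (y x.+1)).
Proof.
move=> fK near.
have -> : \sum_(x < n) sg (y x) * ((f x)%:Z - x%:Z) =
    \sum_(x < n | f x == x.+1 :> nat) sg (y x)
    - \sum_(x < n | x == (f x).+1 :> nat) sg (y x).
  rewrite [X in _ = X - _]big_mkcond [X in _ = _ - X]big_mkcond -sumrB /=.
  apply: eq_bigr => x _; have := near x.
  rewrite /sg; case: (y x); do 2!case: eqP => ?; lia.
rewrite [X in _ - X](reindex_inj (inv_inj fK)) /= sumrB; congr (_ - _).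
by apply: eq_big => [x | x]; rewrite fK // => /eqP ->.
Qed.

(** * Discrepancy of a tuple in terms of descents of its word *)

Definition block t (S : (2 * t).-tuple {set 'I_(4 * t)}) (x : 'I_(4 * t)) : nat :=
  find (fun A : {set 'I_(4 * t)} => x \in A) S.

Definition word t (S : (2 * t).-tuple {set 'I_(4 * t)}) : seq nat :=
  [seq block S x | x <- enum 'I_(4 * t)].

Lemma size_word t (S : (2 * t).-tuple {set 'I_(4 * t)}) : size (word S) = (4 * t)%N.
Proof. by rewrite size_map size_enum_ord. Qed.

Lemma nth_word t (S : (2 * t).-tuple {set 'I_(4 * t)}) (x : 'I_(4 * t)) :
  nth 0%N (word S) x = block S x.
Proof. by rewrite (nth_map x) ?nth_ord_enum // size_enum_ord. Qed.

Section Balanced.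
Variables (t : nat) (S : (2 * t).-tuple {set 'I_(4 * t)}).
Hypothesis balS : S \in balanced t.

Lemma card_block k : (k < 2 * t)%N -> #|nth set0 S k| = 2%N.
Proof.
move=> ltk; move: balS; rewrite inE => /and4P[/forallP/(_ (Ordinal ltk))/eqP + _ _ _].
by rewrite (tnth_nth set0).
Qed.

Lemma Sigma_companion (i : 'I_t) :
  Sigma (nth set0 S (2 * i)) = Sigma (nth set0 S (2 * i).+1).
Proof. by move: balS; rewrite inE => /and4P[_ _ _ /forallP/(_ i)/eqP]. Qed.

Lemma has_block x : has (fun A : {set 'I_(4 * t)} => x \in A) S.
Proof.
move: balS; rewrite inE => /and4P[_ _ /eqP cov _].
have : x \in \bigcup_i tnth S i by rewrite cov inE.
by case/bigcupP=> i _ xi; apply/hasP; exists (tnth S i); rewrite ?mem_tnth.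
Qed.

Lemma block_lt x : (block S x < 2 * t)%N.
Proof. by have := has_block x; rewrite has_find size_tuple. Qed.

Lemma mem_block k x : (k < 2 * t)%N -> (x \in nth set0 S k) = (block S x == k).
Proof.
move=> ltk; have xb : x \in nth set0 S (block S x) := nth_find _ (has_block x).
apply/idP/eqP => [xk | <- //]; apply/eqP; apply: contraTT isT => neq.
move: balS; rewrite inE => /and4P[_ /forallP/(_ (Ordinal (block_lt x)))/forallP].
move=> /(_ (Ordinal ltk))/implyP/(_ neq) + _ _; rewrite !(tnth_nth set0) /=.
by rewrite disjoint_subset => /subsetP/(_ x xb); rewrite inE /= xk.
Qed.

Lemma block_half_lt x : ((block S x)./2 < t)%N.
Proof. by have := block_lt x; lia. Qed.

Lemma Sigma_block k (lt_k : (k < 2 * t)%N) :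
  Sigma (nth set0 S k) = Sigma (nth set0 S (2 * k./2)).
Proof.
have lti : (k./2 < t)%N by lia.
have /= comp := Sigma_companion (Ordinal lti).
have := odd_double_half k; rewrite -mul2n.
by case: (odd k) => Ek; rewrite -{1}Ek ?add1n ?add0n.
Qed.

Lemma sum_sigma_diff (sigma : nat -> bool) (g : 'I_(4 * t) -> int) :
  \sum_(i < t) sg (sigma i) *
    (\sum_(x in nth set0 S (2 * i)) g x - \sum_(x in nth set0 S (2 * i).+1) g x) =
  \sum_(x < 4 * t) sg (colour sigma (block S x)) * g x.
Proof.
rewrite (partition_big (fun x => Ordinal (block_half_lt x)) xpredT) //=.
apply: eq_bigr => i _; rewrite mulrBr !mulr_sumr.
rewrite [RHS](bigID (fun x => ~~ odd (block S x))) /=.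
have lti := ltn_ord i.
rewrite -sumrN; congr (_ + _); apply: eq_big => x.
- by rewrite mem_block -?val_eqE /=; lia.
- rewrite mem_block; last lia.
  move=> /eqP ->; rewrite /colour oddM /= addbF.
  by rewrite mul2n doubleK.
- by rewrite mem_block -?val_eqE /=; lia.
- rewrite mem_block; last lia.
  move=> /eqP ->; rewrite /colour (_ : ((2 * i).+1)./2 = i) /= ?oddM ?addbT; last lia.
  by case: (sigma i); rewrite /= ?mul1r ?mulN1r ?opprK.
Qed.

Definition change I i : int :=
  (Sigma (apply_swaps I (nth set0 S (2 * i))))%:Z
  - (Sigma (apply_swaps I (nth set0 S (2 * i).+1)))%:Z.

(** Companion sums agree before the swaps, so [change I i] is a difference of total displacements
    and [sum_displacement] applies. *)
Lemma sum_sigma_change (sigma : nat -> bool) I : I \in swap_sets t 1 ->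
  \sum_(i < t) sg (sigma i) * change I i =
  \sum_(x < 4 * t | swap_label I x == x.+1 :> nat)
     (sg (colour sigma (nth 0%N (word S) x))
      - sg (colour sigma (nth 0%N (word S) x.+1))).
Proof.
move=> swI; have := swI; rewrite inE => /andP[trivI _].
rewrite -(sum_displacement (fun k => colour sigma (nth 0%N (word S) k))
            (swap_labelK trivI)); last by move=> x; apply: swap_near.
under [RHS]eq_bigr => x _ do rewrite nth_word.
rewrite -(sum_sigma_diff sigma (fun x => (swap_label I x)%:Z - x%:Z)).
apply: eq_bigr => i _; congr (_ * _).
have E A : (Sigma (apply_swaps I A))%:Z =
    \sum_(x in A) ((swap_label I x)%:Z - x%:Z) + (Sigma A)%:Z.
  rewrite Sigma_apply_swaps // /Sigma !(big_morph Posz PoszD (erefl _)).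
  by rewrite -big_split; apply: eq_bigr => x _ /=; lia.
rewrite /change !E Sigma_companion; lia.
Qed.

Definition descents_under sigma := descents false (map (colour sigma) (word S)).

Lemma descents_underE sigma :
  descents_under sigma =
  (\sum_(x < 4 * t) [&& x.+1 < 4 * t, colour sigma (nth 0 (word S) x)
     & ~~ colour sigma (nth 0 (word S) x.+1)])%N.
Proof.
rewrite /descents_under descents_nth size_map size_word.
apply: eq_bigr => x _; case: ltnP => //= lt_x1.
by rewrite !(nth_map 0%N) ?size_word // ltnW.
Qed.

Lemma discrepancy_le I : I \in swap_sets t 1 ->
  exists sigma, (discrepancy S I <= 2 * descents_under sigma)%N.
Proof.
(* Orienting each quadruple by the sign of its change turns the absolute values into a signed
   sum. *)
move=> swI; pose sigma i := 0 <= change I i; exists sigma.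
rewrite -lez_nat /discrepancy (big_morph Posz PoszD (erefl _)).
have -> : \sum_(i < t) (absz (change I i))%:Z = \sum_(i < t) sg (sigma i) * change I i.
  by apply: eq_bigr => i _; rewrite /sigma; case: lerP => /=; lia.
rewrite sum_sigma_change // descents_underE PoszM (big_morph Posz PoszD (erefl _)).
rewrite mulr_sumr big_mkcond; apply: ler_sum => x _.
case: eqP => [E | _]; last by case: (X in _ <= 2 * (nat_of_bool X)%:Z).
rewrite -E ltn_ord; by do 2!case: colour.
Qed.

Lemma discrepancy_ge sigma :
  exists2 I, I \in swap_sets t 1 & (2 * descents_under sigma <= discrepancy S I)%N.
Proof.
pose y k := colour sigma (nth 0%N (word S) k).
(* The witness swaps every descent of the colouring at once. *)
pose D := [set A : {set 'I_(4 * t)} | [exists x, exists z,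
  [&& A == [set x; z], z == x.+1 :> nat, y x & ~~ y z]]].
have DP (A : {set 'I_(4 * t)}) :
    reflect (exists x z : 'I_(4 * t),
               [/\ A = [set x; z], z = x.+1 :> nat, y x & ~~ y z]) (A \in D).
  rewrite inE; apply: (iffP existsP) => [[x /existsP[z /and4P[/eqP ? /eqP ? ? ?]]] | ].
    by exists x, z.
  case=> x [z [-> Ez yx yz]]; exists x; apply/existsP; exists z.
  by apply/and4P; split=> //; apply/eqP.
have swD : D \in swap_sets t 1.
  rewrite inE; apply/andP; split; last first.
    apply/forall_inP=> A /DP[x [z [-> E _ _]]]; apply/andP; split.
      by rewrite cards2 -val_eqE /= E neq_ltn ltnSn.
    apply/forall_inP=> u; rewrite !inE => /orP[]/eqP->;
      apply/forall_inP=> v; rewrite !inE => /orP[]/eqP->; lia.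
  (* The lower end of a descent is coloured true and the upper end false, so no label lies in two
     descents. *)
  apply/trivIsetP=> A B /DP[x [z [-> E yx yz]]] /DP[x' [z' [-> E' yx' yz']]] neq.
  have nexx' : x != x'.
    apply: contraNneq neq => exx'; rewrite exx' (_ : z = z') //.
    by apply: val_inj; rewrite /= E E' exx'.
  have nezz' : z != z'.
    apply: contraNneq nexx' => ezz'; apply/eqP/val_inj/eqP.
    by rewrite -eqSS -E ezz' E'.
  rewrite disjoint_subset; apply/subsetP=> u.
  rewrite !inE => /orP[]/eqP->; rewrite negb_or ?nexx' ?nezz' ?andbT //.
    by apply: contraNneq yz' => <-.
  by apply: contraNneq yz => ->.
exists D => //; have := swD; rewrite inE => /andP[trivD _].
rewrite -lez_nat (_ : (discrepancy S D)%:Z = \sum_(i < t) `|change D i|); last first.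
  by rewrite /discrepancy (big_morph Posz PoszD (erefl _)).
apply: (@le_trans _ _ (\sum_(i < t) sg (sigma i) * change D i)); last first.
  by apply: ler_sum => i _; rewrite /sg; case: (sigma i); lia.
rewrite sum_sigma_change // descents_underE PoszM (big_morph Posz PoszD (erefl _)).
rewrite mulr_sumr [leRHS]big_mkcond; apply: ler_sum => x _; rewrite -!/(y _).
case: eqP => [E | nE].
  have ne : swap_label D x != x by rewrite -val_eqE /= E; lia.
  case: (swap_labelP D x) ne => [-> /eqP // | [ne /DP[u [v [Euv Ev yu yv]]]] _].
  have xu : x = u.
    apply: val_inj => /=; move/setP: Euv => Euv.
    have := Euv x; have := Euv u; have := Euv v; have := Euv (swap_label D x).
    by rewrite !inE !eqxx /= -!val_eqE /= E Ev; lia.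
  by rewrite xu -Ev yu (negPf yv) ltn_ord.
case: ltnP => //= ltx; case: (boolP (y x && _)) => // /andP[yx yx1].
case: nE; rewrite (@swap_labelE _ _ trivD x (Ordinal ltx)) //.
  by rewrite -val_eqE /=; lia.
by apply/DP; exists x, (Ordinal ltx).
Qed.

End Balanced.

(** * Lower bound: averaging over orientations *)

Lemma card_repeats t (S : (2 * t).-tuple {set 'I_(4 * t)}) : S \in balanced t ->
  (#|[set x : 'I_(4 * t) | (x.+1 < 4 * t) &&
       (nth 0 (word S) x == nth 0 (word S) x.+1)]| <= t)%N.
Proof.
move=> balS; set B := [set x | _].
pose q x := Ordinal (block_half_lt balS x).
suff /card_in_imset <- : {in B &, injective q} by rewrite -[leqRHS]card_ord max_card.
(* A repeat fills its block with the integers [x + 1] and [x + 2]; the sum [2 * x + 3] is shared by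
   the companion, so the quadruple determines [x]. *)
have sumB x : x \in B -> Sigma (nth set0 S (2 * (block S x)./2)) = (2 * x + 3)%N.
  rewrite inE => /andP[ltx]; rewrite nth_word -[x.+1]/(val (Ordinal ltx)) nth_word.
  move=> /eqP Exx1; rewrite -Sigma_block ?block_lt //.
  have <- : [set x; Ordinal ltx] = nth set0 S (block S x).
    apply/eqP; rewrite eqEcard card_block ?block_lt // cards2 -val_eqE /=.
    rewrite neq_ltn ltnSn andbT; apply/subsetP=> u.
    by rewrite !inE mem_block ?block_lt // => /orP[]/eqP->; rewrite ?Exx1.
  rewrite /Sigma big_setU1 ?big_set1 /=; first by lia.
  by rewrite inE -val_eqE /= neq_ltn ltnSn.
move=> x x' xB x'B /(congr1 val) /= Eq; apply: val_inj => /=.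
by have := sumB _ xB; rewrite Eq sumB //; lia.
Qed.

(** Distinct companions always differ in colour. Otherwise [flip] reverses the quadruple of [p]
    alone, so exactly one of [f] and [flip f] separates [p] from [r]. *)
Lemma sum_colour_change m (p r : nat) : (p./2 <= m)%N -> (r./2 <= m)%N -> p != r ->
  (#|{ffun 'I_m.+1 -> bool}| <=
   2 * \sum_(f : {ffun 'I_m.+1 -> bool})
     (colour (fun i => f (inord i)) p != colour (fun i => f (inord i)) r))%N.
Proof.
move=> lep ler nepr.
case: (eqVneq p./2 r./2) => [Epr | Npr].
  rewrite -sum1_card big_distrr /=; apply: leq_sum => f _.
  rewrite /colour Epr; case: (boolP (odd p == odd r)).
    move=> /eqP Eo; case/eqP: nepr.
    by rewrite -(odd_double_half p) Eo Epr odd_double_half.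
  by case: (f _); case: (odd p); case: (odd r).
pose flip (f : {ffun 'I_m.+1 -> bool}) := [ffun i => f i (+) (i == inord p./2)].
have flipK : involutive flip.
  by move=> f; apply/ffunP=> i; rewrite !ffunE -addbA addbb addbF.
rewrite mul2n -addnn {2}(reindex_inj (inv_inj flipK)) -big_split -sum1_card /=.
apply: leq_sum => f _; rewrite /colour !ffunE eqxx.
have -> : (inord r./2 == inord p./2 :> 'I_m.+1) = false.
  by rewrite -val_eqE /= !inordK // eq_sym (negPf Npr).
by rewrite addbF; case: (f _); case: (f _); case: (odd p); case: (odd r).
Qed.

Lemma many_descents t (S : (2 * t).-tuple {set 'I_(4 * t)}) : S \in balanced t ->
  exists sigma, (3 * t <= 4 * descents_under S sigma + 1)%N.
Proof.
move=> balS.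
pose w := nth 0%N (word S).
(* The index type ['I_t.+1] is nonempty for every [t], as [inord] requires. *)
pose changes (f : {ffun 'I_t.+1 -> bool}) := (\sum_(x < 4 * t) ((x.+1 < 4 * t) &&
  (colour (fun i => f (inord i)) (w x) != colour (fun i => f (inord i)) (w x.+1))))%N.
have [f lef] : exists f, (3 * t <= 2 * changes f + 1)%N.
  (* If every orientation failed, the doubled changes would average at most [3 * t - 2]; double
     counting over adjacent labels gives at least [3 * t - 1]. *)
  apply/existsP; apply: contraT; rewrite negb_exists => /forallP few.
  have Nt0 : (0 < t)%N by have := few [ffun=> true]; lia.
  pose N := #|{ffun 'I_t.+1 -> bool}|.
  have N0 : (0 < N)%N by apply/card_gt0P; exists [ffun=> true].
  have : (\sum_f (2 * changes f) <= N * (3 * t - 2))%N.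
    rewrite /N -sum_nat_const; apply: leq_sum => f _; have := few f; lia.
  have : (N * (3 * t - 1) <= \sum_f (2 * changes f))%N.
    rewrite -big_distrr /= /changes exchange_big big_distrr /=.
    apply: (@leq_trans (\sum_(x < 4 * t) ((x.+1 < 4 * t) && (w x != w x.+1)) * N)%N).
      rewrite -big_distrl mulnC leq_mul2r; apply/orP; right => /=.
      have := card_repeats balS; rewrite -sum1_card big_mkcond /=.
      rewrite -(leq_add2l (\sum_(x < 4 * t) ((x.+1 < 4 * t) && (w x != w x.+1)))%N).
      rewrite -big_split /=.
      rewrite (eq_bigr (fun x : 'I_(4 * t) => nat_of_bool (x.+1 < 4 * t)%N));
        last first.
        by move=> x _; rewrite inE -!/(w _); case: ltnP; case: eqP.
      have -> : (\sum_(x < 4 * t) (x.+1 < 4 * t) = 4 * t - 1)%N.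
        have -> : (4 * t = (4 * t - 1).+1)%N by lia.
        rewrite big_ord_recr /= ltnn addn0 (eq_bigr (fun=> 1%N)).
          by rewrite sum1_card card_ord subSS subn0.
        by move=> x _; rewrite ltnS ltn_ord.
      lia.
    apply: leq_sum => x _; case: ltnP => //= ltx; case: eqP => //= /eqP ne.
    have wlt (z : 'I_(4 * t)) : ((w z)./2 <= t)%N.
      by rewrite /w nth_word ltnW // block_half_lt.
    by rewrite mul1n; apply: sum_colour_change ne; rewrite ?(wlt (Ordinal ltx)).
  by move=> h1 h2; have := leq_trans h1 h2; rewrite leq_mul2l; lia.
pose s i := f (inord i).
(* A change is a descent or an ascent, and reversing the orientation turns ascents into descents. *)
have : (changes f = descents_under S s + descents_under S (negb \o s))%N.
  rewrite !descents_underE -big_split; apply: eq_bigr => x _ /=.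
  rewrite /colour /= -!/(w _) -!/(s _) !addNb.
  by case: ltnP; case: (_ (+) _); case: (_ (+) _).
case: (leqP (descents_under S s) (descents_under S (negb \o s))) => ? E.
  by exists (negb \o s); lia.
by exists s; lia.
Qed.

Lemma Dstar_ge t : (3 * t <= 2 * Dstar t 1 + 1)%N.
Proof.
rewrite /Dstar; case: ex_minnP => d /existsP[S /andP[balS /eqP <-]] _.
have [sigma many] := many_descents balS.
have [I swI leI] := discrepancy_ge balS sigma.
have : (discrepancy S I <= max_discrepancy 1 S)%N.
  by rewrite /max_discrepancy (bigD1 I) //= leq_maxl.
lia.
Qed.

Lemma Dstar_le t M (S : (2 * t).-tuple {set 'I_(4 * t)}) : S \in balanced t ->
  (forall sigma, descents_under S sigma <= M)%N -> (Dstar t 1 <= 2 * M)%N.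
Proof.
move=> balS few; rewrite /Dstar; case: ex_minnP => d _ mind.
apply: (@leq_trans (max_discrepancy 1 S)).
  by apply: mind; apply/existsP; exists S; rewrite balS eqxx.
apply/bigmax_leqP=> I swI; have [sigma le] := discrepancy_le balS swI.
by apply: leq_trans le _; rewrite leq_mul2l few.
Qed.

(** * Upper bound: words and their doubling *)

Definition pos_sum (p : nat) (w : seq nat) : nat :=
  (\sum_(i < size w | nth 0 w i == p) i)%N.

Lemma pos_sum_cons p x w : pos_sum p (x :: w) = (pos_sum p w + count_mem p w)%N.
Proof.
have count_nth : (count_mem p w = \sum_(i < size w | nth 0 w i == p) 1)%N.
  by rewrite -sum1_count (big_nth 0%N) big_mkord.
rewrite /pos_sum count_nth -big_split big_mkcond big_ord_recl /= if_same add0n.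
by rewrite [RHS]big_mkcond; apply: eq_bigr => i _; rewrite /= /bump addn1.
Qed.

Lemma pos_sum_cat p u v :
  pos_sum p (u ++ v) = (pos_sum p u + (pos_sum p v + size u * count_mem p v))%N.
Proof.
elim: u => [|x u IHu]; first by rewrite {2}/pos_sum big_ord0 addn0.
rewrite cat_cons !pos_sum_cons IHu count_cat /=; lia.
Qed.

Lemma pos_sum_map_inj (f : nat -> nat) p w : injective f ->
  pos_sum (f p) (map f w) = pos_sum p w.
Proof.
move=> injf; elim: w => [|x w IHw]; first by rewrite /pos_sum !big_ord0.
rewrite /= !pos_sum_cons IHw count_map; congr (_ + _)%N.
by apply: eq_count => y /=; rewrite inj_eq.
Qed.

Lemma pos_sum_notin p w : p \notin w -> pos_sum p w = 0%N.
Proof.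
elim: w => [|x w IHw]; first by rewrite /pos_sum big_ord0.
rewrite inE negb_or => /andP[_ pw]; rewrite pos_sum_cons IHw //.
by rewrite (count_memPn pw).
Qed.

(** Balance and the descent bound are phrased for words so that doubling becomes concatenation. *)
Record good_word (t M : nat) (w : seq nat) : Prop := GoodWord {
  good_size : size w = (4 * t)%N;
  good_letters : {in w, forall p, p < 2 * t}%N;
  good_count : forall p, (p < 2 * t)%N -> count_mem p w = 2%N;
  good_pos_sum : forall i, (i < t)%N -> pos_sum (2 * i) w = pos_sum (2 * i).+1 w;
  good_descents : forall sigma, (descents false (map (colour sigma) w) <= M)%N }.

Definition base_word := [:: 1; 3; 5; 2; 2; 4; 3; 0; 0; 7; 4; 6; 6; 5; 7; 1]%N.

Lemma good_base : good_word 4 3 base_word.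
Proof.
split=> //.
- by apply/allP.
- by do 8!case=> //.
- by do 4?[case=> [_|]; first by rewrite /base_word !pos_sum_cons /pos_sum !big_ord0].
- move=> sigma; rewrite /colour /=.
  by case: (sigma 0%N); case: (sigma 1%N); case: (sigma 2%N); case: (sigma 3%N).
Qed.

(* With [c], [a] the two blocks of a new quadruple, this is [c w a a w' c], where [w']
   is a copy of [w] on fresh quadruples. The colours of [c] and [a] are opposite: one
   of the two copies is read as [- w +], which creates no descent, the other as
   [+ w -], whose descents are the ascents of [w] and one more. *)
Definition double_word t (w : seq nat) : seq nat :=
  ((4 * t).+1 :: w) ++ [:: 4 * t, 4 * t & rcons (map (addn (2 * t)) w) (4 * t).+1]%N.

Lemma descents_double t M w sigma : good_word t M w ->
  (descents false (map (colour sigma) (double_word t w)) <= 2 * M + 1)%N.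
Proof.
case=> _ _ _ _ few; rewrite /double_word.
have E4 : colour sigma (4 * t) = sigma (2 * t)%N.
  by rewrite /colour oddM addbF (_ : (4 * t)./2 = (2 * t)%N) //; lia.
have E41 : colour sigma (4 * t).+1 = ~~ sigma (2 * t)%N.
  by rewrite /colour /= oddM addbT (_ : uphalf (4 * t) = (2 * t)%N) //; lia.
(* As [few] covers reversed orientations, it bounds the ascents of [w] too. *)
have Eneg s : map negb (map (colour s) w) = map (colour (negb \o s)) w.
  by rewrite -map_comp; apply: eq_map => p; rewrite /colour /= addNb.
have Eshift : map (colour sigma) (map (addn (2 * t)) w) =
    map (colour (fun i => sigma (t + i)%N)) w.
  rewrite -map_comp; apply: eq_map => p /=; rewrite /colour oddD oddM /=.
  by rewrite (_ : (2 * t + p)./2 = t + p./2)%N //; lia.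
rewrite map_cat /= map_rcons Eshift E4 E41 descents_cat /=.
case: (sigma (2 * t)%N) => /=.
  rewrite andbF !add0n descents_rcons_false Eneg /=.
  by have := few sigma; have := few (negb \o (fun i => sigma (t + i)%N)); lia.
rewrite andbT !add0n descents_rcons_true.
have := descents_rcons_false true (map (colour sigma) w).
rewrite -cats1 descents_cat /= addn0 andbT Eneg /=.
by have := few (negb \o sigma); have := few (fun i => sigma (t + i)%N); lia.
Qed.

Lemma good_double t M w :
  good_word t M w -> good_word (2 * t + 1) (2 * M + 1) (double_word t w).
Proof.
move=> good; have [sz letters cnt bal few] := good.
have notin p : (2 * t <= p)%N -> p \notin w.
  by move=> le; apply/negP => /letters; lia.
have inj : injective (addn (2 * t)) by apply: addnI.
have notin_shift p : (p < 2 * t)%N || (4 * t <= p)%N -> p \notin map (addn (2 * t)) w.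
  by move=> le; apply/mapP => -[q /letters]; lia.
have count_shift p : count_mem (2 * t + p)%N (map (addn (2 * t)) w) = count_mem p w.
  by rewrite count_map; apply: eq_count => q /=; rewrite inj_eq.
have cntE p : count_mem p (double_word t w) =
    (2 * (p == (4 * t).+1) + 2 * (p == 4 * t) + count_mem p w
     + count_mem p (map (addn (2 * t)) w))%N.
  rewrite /double_word count_cat /= -cats1 count_cat /= !(eq_sym p); lia.
(* The word [w] starts at position [1] and its copy at [4 * t + 3]. The new letters occupy [0],
   [8 * t + 3] and [4 * t + 1], [4 * t + 2], both pairs with sum [8 * t + 3]. *)
have psE p : pos_sum p (double_word t w) =
    (pos_sum p w + count_mem p w
     + pos_sum p (map (addn (2 * t)) w)
     + (4 * t + 3) * count_mem p (map (addn (2 * t)) w)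
     + (8 * t + 3) * (p == (4 * t).+1) + (8 * t + 3) * (p == 4 * t))%N.
  rewrite /double_word pos_sum_cat /= !pos_sum_cons -cats1 pos_sum_cat /=.
  rewrite pos_sum_cons count_cat /= size_map sz !(eq_sym p).
  have -> : pos_sum p [::] = 0%N by rewrite /pos_sum big_ord0.
  lia.
split.
- by rewrite /double_word size_cat /= size_rcons size_map sz; lia.
- move=> p; rewrite /double_word mem_cat !inE mem_rcons inE.
  case/orP => [/orP[/eqP -> | /letters] | ]; try lia.
  case/or4P => [/eqP -> | /eqP -> | /eqP -> | /mapP[q /letters + ->]]; lia.
- move=> p ltp; rewrite cntE.
  case: (ltnP p (2 * t)) => [lt1 | le1].
    by rewrite cnt // (count_memPn (notin_shift p _)) ?lt1 //; lia.
  rewrite (count_memPn (notin _ le1)).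
  case: (ltnP p (4 * t)) => [lt2 | le2].
    have -> : p = (2 * t + (p - 2 * t))%N by lia.
    by rewrite count_shift cnt; lia.
  by rewrite (count_memPn (notin_shift p _)) ?le2 ?orbT //; lia.
- move=> i lti; rewrite !psE.
  case: (ltnP i t) => [lt1 | le1].
    rewrite bal // !cnt; [|lia|lia].
    have n1 : (2 * i)%N \notin map (addn (2 * t)) w by apply: notin_shift; lia.
    have n2 : (2 * i).+1 \notin map (addn (2 * t)) w by apply: notin_shift; lia.
    rewrite !(count_memPn n1, count_memPn n2, pos_sum_notin n1, pos_sum_notin n2).
    lia.
  have n1 : (2 * i)%N \notin w by apply: notin; lia.
  have n2 : (2 * i).+1 \notin w by apply: notin; lia.
  rewrite !(count_memPn n1, count_memPn n2, pos_sum_notin n1, pos_sum_notin n2).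
  case: (ltnP i (2 * t)) => [lt2 | le2].
    have -> : (2 * i).+1 = (2 * t + (2 * (i - t)).+1)%N by lia.
    have -> : (2 * i = 2 * t + 2 * (i - t))%N by lia.
    rewrite !count_shift !pos_sum_map_inj // !cnt; [|lia|lia].
    rewrite bal; lia.
  have m1 : (2 * i)%N \notin map (addn (2 * t)) w by apply: notin_shift; lia.
  have m2 : (2 * i).+1 \notin map (addn (2 * t)) w by apply: notin_shift; lia.
  rewrite !(count_memPn m1, count_memPn m2, pos_sum_notin m1, pos_sum_notin m2).
  lia.
- by move=> sigma; apply: descents_double good.
Qed.

(** Both [t + 1] and [M + 1] double at each step, starting from [5] and [4]. *)
Lemma good_word_exists z :
  exists w, good_word (5 * 2 ^ z - 1) (2 ^ (z + 2) - 1) w.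
Proof.
elim: z => [|z [w /good_double good]]; first by exists base_word; apply: good_base.
exists (double_word (5 * 2 ^ z - 1) w); move: good.
have := expn_gt0 2 z; rewrite /= addSn !expnS => pos.
congr (good_word _ _ _); lia.
Qed.

Lemma good_word_balanced t M w : good_word t M w ->
  exists2 S, S \in balanced t & word S = w.
Proof.
case=> sz letters cnt bal _.
pose blk k := [set x : 'I_(4 * t) | nth 0%N w x == k].
pose S : (2 * t).-tuple {set 'I_(4 * t)} := [tuple blk k | k < 2 * t].
have nthS k : (k < 2 * t)%N -> nth set0 S k = blk k.
  by move=> ltk; rewrite -[k]/(val (Ordinal ltk)) -tnth_nth tnth_mktuple.
have ltw (x : 'I_(4 * t)) : (nth 0%N w x < 2 * t)%N.
  by apply: letters; rewrite mem_nth // sz.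
have card_blk k : (k < 2 * t)%N -> #|blk k| = 2%N.
  move=> ltk; transitivity (count_mem k w); last exact: cnt.
  rewrite -sum1_count (big_nth 0%N) big_mkord sz -sum1_card.
  by apply: eq_bigl => x; rewrite inE.
(* Labels are positions plus one and a block has two labels, so the offset is the same for both
   companions. *)
have Sigma_blk k : (k < 2 * t)%N -> Sigma (blk k) = (pos_sum k w + 2)%N.
  move=> ltk; transitivity (pos_sum k w + #|blk k|)%N; last by rewrite card_blk.
  rewrite -sum1_card /pos_sum sz /Sigma.
  have memE x : (x \in blk k) = (nth 0%N w x == k) by rewrite inE.
  rewrite !(eq_bigl _ _ memE).
  by rewrite -big_split; apply: eq_bigr => x _; rewrite /= addn1.
exists S.
  rewrite inE; apply/and4P; split.
  - by apply/forallP=> i; rewrite tnth_mktuple card_blk.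
  - apply/forallP=> i; apply/forallP=> j; apply/implyP=> neij; rewrite !tnth_mktuple.
    apply/pred0P=> x /=; rewrite !inE; apply/negP => /andP[/eqP -> /eqP Eij].
    by case/eqP: neij; apply: val_inj.
  - apply/eqP/setP=> x; rewrite inE; apply/bigcupP.
    by exists (Ordinal (ltw x)); rewrite // tnth_mktuple inE.
  - apply/forallP=> i; have lti := ltn_ord i.
    rewrite !nthS; [|lia|lia].
    by rewrite !Sigma_blk ?bal //; lia.
apply: (@eq_from_nth _ 0%N); first by rewrite size_word sz.
rewrite size_word => k ltk; rewrite -[k]/(val (Ordinal ltk)) nth_word.
have hasS : has (fun A : {set 'I_(4 * t)} => Ordinal ltk \in A) S.
  apply/hasP; exists (tnth S (Ordinal (ltw (Ordinal ltk)))); first exact: mem_tnth.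
  by rewrite tnth_mktuple inE.
have := nth_find set0 hasS; rewrite -/(block S _) nthS; first by rewrite inE => /eqP.
by move: hasS; rewrite has_find size_tuple.
Qed.

Theorem theorem3 :
  (forall t : nat, (0 < t)%N ->
     (3 * t%:R - 2) / 2 <= (Dstar t 1)%:R :> rat)
  /\
  (forall z t : nat, (2 <= z)%N -> t = (5 * 2 ^ (z - 2) - 1)%N ->
     (Dstar t 1)%:R <= 2 ^+ (z + 1) - 2 :> rat
     /\ (Dstar t 1)%:R <= (8 * t%:R - 2) / 5 :> rat)
  /\
  (exists z0 : nat, forall z t : nat,
     (z0 <= z)%N -> (2 <= z)%N -> t = (5 * 2 ^ (z - 2) - 1)%N ->
     (8 * t%:R - 2) / 5 <= 107 / 100 * ((3 * t%:R - 2) / 2) :> rat).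
Proof.
split=> [t _ | ].
  have := Dstar_ge t; rewrite -(ler_nat rat) natrD !natrM; lra.
have tE z t : (2 <= z)%N -> t = (5 * 2 ^ (z - 2) - 1)%N ->
    t%:R = 5 * 2 ^+ (z - 2) - 1 :> rat.
  by move=> _ ->; rewrite natrB ?natrM ?natrX // muln_gt0 expn_gt0.
split=> [z t lez Et | ].
  have [w good] := good_word_exists (z - 2); rewrite -Et subnK // in good.
  have [S balS Ew] := good_word_balanced good.
  have : (Dstar t 1 <= 2 * (2 ^ z - 1))%N.
    apply: Dstar_le balS _ => sigma.
    by rewrite /descents_under Ew; apply: good_descents good _.
  (* With [u = 2 ^ (z - 2)], both upper bounds equal [8 u - 2]. *)
  rewrite -(ler_nat rat) natrM natrB ?expn_gt0 // natrX (tE z t lez Et) addn1 exprS.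
  have -> : 2 ^+ z = 2 ^+ (z - 2) * 4 :> rat by rewrite -{1}(subnK lez) exprD; lra.
  lra.
(* With [u = 2 ^ (z - 2)] the claim is [8 u - 2 <= 1.07 (15 u - 5) / 2], that is [u >= 27]; from
   [z >= 10] comes [u >= 256]. *)
exists 10%N => z t le10 lez Et; rewrite (tE z t lez Et).
have : 2 ^+ 8 <= 2 ^+ (z - 2) :> rat by rewrite ler_eXn2l //; lia.
by rewrite -natrX; lra.
Qed.
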